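(* The diagonal implicit Runge-Kutta methods for the stochastic Poisson system $dy=B(y)\big(\nabla H_0(y)\,dt+\sum_{r=1}^m\nabla H_r(y)\circ dW_r(t)\big)$ in $\mathbb{R}^d$ (the methods proposed as a composite of $s$ midpoint methods with variable coefficients) can be written in the form of the $s$-stage stochastic Runge-Kutta method with Butcher tableau $$\begin{array}{|ccccccccccccc} \frac{b_1^{0}}{2} & & & & \frac{b_1^{1}}{2} & & & & \cdots & \frac{b_1^{m}}{2} & & & \\ b_1^{0} & \frac{b_2^{0}}{2} & & & b_1^{1} & \frac{b_2^{1}}{2} & & & \cdots & b_1^{m} & \frac{b_2^{m}}{2} & & \\ \vdots & \vdots & \ddots & & \vdots & \vdots & \ddots & & \cdots & \vdots & \vdots & \ddots & \\ b_1^{0} & b_2^{0} & \cdots & \frac{b_s^{0}}{2} & b_1^{1} & b_2^{1} & \cdots & \frac{b_s^{1}}{2} & \cdots & b_1^{m} & b_2^{m} & \cdots & \frac{b_s^{m}}{2}\\ \hline b_1^{0} & b_2^{0} & \cdots & b_s^{0} & b_1^{1} & b_2^{1} & \cdots & b_s^{1} & \cdots & b_1^{m} & b_2^{m} & \cdots & b_s^{m} \end{array}$$ where $b_s^l=1-b_1^l-\cdots-b_{s-1}^l$ for $l=0,\dots,m$.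
   Context: $H_0,\dots,H_m:\mathbb{R}^d\to\mathbb{R}$ are smooth; $B(y)=(b_{ij}(y))\in\mathbb{R}^{d\times d}$ is a skew-symmetric matrix function satisfying the Jacobi identity $\sum_{q=1}^d\big(\frac{\partial b_{ij}}{\partial y_q}b_{qk}+\frac{\partial b_{jk}}{\partial y_q}b_{qi}+\frac{\partial b_{ki}}{\partial y_q}b_{qj}\big)=0$ for all $i,j,k$ (its entries are unrelated to the weights $b_i^l$); $W=(W_1,\dots,W_m)$ is an $m$-dimensional standard Wiener process and $\circ$ is the Stratonovich product. Put $f_l(y)=B(y)\nabla H_l(y)$, $l=0,\dots,m$; $h$ is the time step and $J_k^r=W_r(t_{k+1})-W_r(t_k)$. Meaning of the tableau: it has $m+1$ blocks, the $l$-th block ($l=0,\dots,m$) consisting of the matrix $(a_{ij}^l)_{i,j=1}^s$ above the line and the row vector $(b_1^l,\dots,b_s^l)$ below it; blank entries are zero. It represents the method $$Y_i=y_k+h\sum_{j=1}^{s}a_{ij}^0f_0(Y_j)+\sum_{r=1}^m\sum_{j=1}^{s}a_{ij}^rf_r(Y_j)J_k^r\quad(i=1,\dots,s),$$ $$y_{k+1}=y_k+h\sum_{i=1}^sb_i^0f_0(Y_i)+\sum_{r=1}^m\sum_{i=1}^sb_i^rf_r(Y_i)J_k^r.$$ So here $a_{ij}^l=b_j^l$ for $i>j$, $a_{ii}^l=\tfrac12b_i^l$, and $a_{ij}^l=0$ for $i<j$. Meaning of ''composite of $s$ midpoint methods with variable coefficients'': the midpoint method is applied over $s$ successive substeps $y_k\to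 y_{k+\frac1s}\to\cdots\to y_{k+1}$ with time steps $b_1^0h,\dots,b_s^0h$ and with diffusion coefficients $b_i^rf_r$ in the $i$-th substep, i.e. $y_{k+\frac{i}{s}}=y_{k+\frac{i-1}{s}}+b_i^0h\,f_0(M_i)+\sum_{r=1}^m b_i^rf_r(M_i)J_k^r$ with $M_i=\frac12\big(y_{k+\frac{i}{s}}+y_{k+\frac{i-1}{s}}\big)$, $i=1,\dots,s$. *)

(* Defs.v *)
From HB Require Import structures.
From mathcomp Require Export all_boot all_order all_algebra.
From mathcomp Require Export all_classical all_reals all_analysis.
Export Order.TTheory GRing.Theory Num.Theory.
Export numFieldNormedType.Exports.

Set Implicit Arguments.
Unset Strict Implicit.
Unset Printing Implicit Defensive.

Local Open Scope classical_set_scope.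
Local Open Scope ring_scope.

Section Calculus.
Context {R : realType} {d : nat}.
Implicit Types (F : 'cV[R]_d -> R) (B : 'cV[R]_d -> 'M[R]_d) (y : 'cV[R]_d).

Definition has_partials F : Prop :=
  forall (q : 'I_d) y, derivable F y (delta_mx q 0).

Definition partial (q : 'I_d) F : 'cV[R]_d -> R :=
  fun y => 'D_(delta_mx q 0) F y.

Definition gradient F y : 'cV[R]_d := \col_q partial q F y.

Fixpoint class_C (k : nat) F : Prop :=
  if k is k'.+1 then
    [/\ continuous F, has_partials F & forall q, class_C k' (partial q F)]
  else continuous F.

Definition smooth F : Prop := forall k, class_C k F.

Definition skew_symmetric B : Prop := forall y, (B y)^T = - B y.

(* 'D_v is total, so the existence of the partial derivatives of the entries
   is part of the condition. *)
Definition satisfies_jacobi B : Prop :=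
  (forall i j : 'I_d, has_partials (fun z => B z i j)) /\
  forall (i j k : 'I_d) y,
    \sum_(q < d) (partial q (fun z => B z i j) y * B y q k
                + partial q (fun z => B z j k) y * B y q i
                + partial q (fun z => B z k i) y * B y q j) = 0.

End Calculus.

Section Wiener.
Context {R : realType} {disp : measure_display} {Omega : measurableType disp}.
Variable P : probability Omega R.

(* Taking some of the A i to be the whole line gives the product rule for
   every subfamily. *)
Definition mutually_independent (I : finType) (X : I -> Omega -> R) : Prop :=
  forall A : I -> set R, (forall i, measurable (A i)) ->
    P (\bigcap_(i : I) (X i @^-1` A i)) = (\prod_(i : I) P (X i @^-1` A i))%E.

(* The independence clause ranges over all components and all intervals of a
   time grid jointly, which covers both the independence of increments and
   the independence of components. *)
Record standard_wiener (m : nat) (W : 'I_m -> R -> {RV P >-> R}) : Prop := {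
  wiener_start : forall r, {ae P, forall w, W r 0 w = 0} ;
  wiener_paths : forall r,
    {ae P, forall w, {within `[0, +oo[, continuous (fun t : R => W r t w)}} ;
  wiener_gaussian : forall r (t1 t2 : R), 0 <= t1 -> t1 < t2 ->
    forall A : set R, measurable A ->
      P ((fun w => W r t2 w - W r t1 w) @^-1` A)
      = normal_prob 0 (Num.sqrt (t2 - t1)) A ;
  wiener_indep : forall (n : nat) (t : nat -> R),
    0 <= t 0%N -> (forall i, (i < n)%N -> t i <= t i.+1) ->
    mutually_independent
      (fun (p : 'I_m * 'I_n) w => W p.1 (t p.2.+1) w - W p.1 (t p.2) w)
}.

End Wiener.

(* A family indexed by l = 0, ..., m is a function on 'I_m.+1; for r : 'I_m,
   the member of index r + 1 (the r-th noise) is the one at lift ord0 r.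
   The methods are implicit, so each is the relation between y_k and y_{k+1}
   that it imposes. *)
Section Methods.
Context {R : realType} {d m s : nat}.
Implicit Types (f : 'I_m.+1 -> 'cV[R]_d -> 'cV[R]_d) (h : R) (J : 'I_m -> R).
Implicit Types (y : 'cV[R]_d) (b : 'I_m.+1 -> 'I_s -> R).

Definition poisson_field (B : 'cV[R]_d -> 'M[R]_d)
    (H : 'I_m.+1 -> 'cV[R]_d -> R) : 'I_m.+1 -> 'cV[R]_d -> 'cV[R]_d :=
  fun l y => B y *m gradient (H l) y.

Definition midpoint_step (h : R) (f0 : 'cV[R]_d -> 'cV[R]_d)
    (g : 'I_m -> 'cV[R]_d -> 'cV[R]_d) J y y' : Prop :=
  let M := 2^-1 *: (y' + y) in
  y' = y + h *: f0 M + \sum_(r < m) J r *: g r M.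

(* u i is the intermediate value y_{k+i/s}. The substep from u i to u i.+1
   has weights b l i, as 'I_s numbers from 0 the substeps 1, ..., s. *)
Definition midpoint_composite b f h J y y' : Prop :=
  exists u : nat -> 'cV[R]_d,
    [/\ u 0%N = y, u s = y' &
      forall i : 'I_s,
        midpoint_step (b ord0 i * h) (f ord0)
          (fun r x => b (lift ord0 r) i *: f (lift ord0 r) x) J
          (u i) (u i.+1)].

Record tableau := Tableau {
  tab_a : 'I_m.+1 -> 'M[R]_s ;
  tab_b : 'I_m.+1 -> 'rV[R]_s
}.

Definition srk_step (T : tableau) f h J y y' : Prop :=
  exists Y : 'I_s -> 'cV[R]_d,
    (forall i, Y i = y
       + h *: \sum_(j < s) tab_a T ord0 i j *: f ord0 (Y j)
       + \sum_(r < m) \sum_(j < s)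
           (tab_a T (lift ord0 r) i j * J r) *: f (lift ord0 r) (Y j)) /\
    y' = y
       + h *: \sum_(i < s) tab_b T ord0 0 i *: f ord0 (Y i)
       + \sum_(r < m) \sum_(i < s)
           (tab_b T (lift ord0 r) 0 i * J r) *: f (lift ord0 r) (Y i).

Definition dirk_tableau b : tableau := Tableau
  (fun l => \matrix_(i, j)
     if (j < i)%N then b l j else if j == i then b l j / 2 else 0)
  (fun l => \row_j b l j).

End Methods.
Arguments tableau : clear implicits.

(* Main.v *)
Require Import Defs.

(* With M_i the midpoints, u_i = y + sum_{j <= i} g_j(M_j), where g_j is the
   increment of the j-th substep.  Hence M_i = u_{i-1} + g_i(M_i) / 2 is y plus
   a combination of the g_j(M_j) with weights 1 for j < i and 1/2 for j = i,
   which is the i-th stage equation of the tableau.  Conversely, partial sums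
   of the stage increments recover the u_i. *)

Set Implicit Arguments.
Unset Strict Implicit.
Unset Printing Implicit Defensive.

Local Open Scope classical_set_scope.
Local Open Scope ring_scope.

(** The factor of the tableau entry $a_{ij}^l$ in front of $b_j^l$. It is the same for every block
    [l], so drift and noise terms can be treated together. *)
Definition midpoint_weight (R : fieldType) (s : nat) (i j : 'I_s) : R :=
  if (j < i)%N then 1 else if j == i then 2^-1 else 0.
Arguments midpoint_weight : clear implicits.

Lemma sum_ord_ltS (V : nmodType) (s : nat) (i : 'I_s) (F : 'I_s -> V) :
  \sum_(j < s | (j < i.+1)%N) F j = \sum_(j < s | (j < i)%N) F j + F i.
Proof.
rewrite (bigD1 i) //= addrC; congr (_ + _); apply: eq_bigl => j.
by rewrite ltnS -val_eqE andbC -ltn_neqAle.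
Qed.

Lemma sum_midpoint_weight (R : fieldType) (V : lmodType R) (s : nat)
    (i : 'I_s) (F : 'I_s -> V) :
  \sum_(j < s) midpoint_weight R s i j *: F j
  = \sum_(j < s | (j < i)%N) F j + 2^-1 *: F i.
Proof.
rewrite (bigID (fun j : 'I_s => (j < i)%N)) /=; congr (_ + _).
  by apply: eq_bigr => j; rewrite /midpoint_weight => ->; rewrite scale1r.
rewrite (bigD1 i) ?ltnn //= {1}/midpoint_weight ltnn eqxx big1 ?addr0 //.
move=> j /andP[/negbTE jlti /negbTE jneqi].
by rewrite /midpoint_weight jlti jneqi scale0r.
Qed.

(** The algebraic core, for arbitrary increment maps [g]: [Y i] is the midpoint of [u i] and
    [u i.+1], and [u] is the sequence of partial sums of the increments. *)
Lemma midpoint_chainP (R : numFieldType) (V : lmodType R) (s : nat)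
    (g : 'I_s -> V -> V) (y y' : V) :
  (exists u : nat -> V, [/\ u 0%N = y, u s = y' &
     forall i : 'I_s, u i.+1 = u i + g i (2^-1 *: (u i.+1 + u i))]) <->
  (exists Y : 'I_s -> V,
     (forall i, Y i = y + \sum_(j < s) midpoint_weight R s i j *: g j (Y j)) /\
     y' = y + \sum_(i < s) g i (Y i)).
Proof.
(* The midpoint of [v] and [v + a]: the source of the diagonal weight 1/2. *)
have half (v a : V) : 2^-1 *: (v + a + v) = v + 2^-1 *: a :> V.
  rewrite addrAC scalerDr -mulr2n -[v *+ 2]scaler_nat scalerA.
  by rewrite mulVf ?pnatr_eq0 // scale1r.
have sum_s (F : 'I_s -> V) : \sum_(j < s | (j < s)%N) F j = \sum_(j < s) F j.
  by apply: eq_bigl => j; rewrite ltn_ord.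
split=> [[u [u0 us uS]]|[Y [YE y'E]]].
  pose Y (i : 'I_s) := 2^-1 *: (u i.+1 + u i).
  (* Telescoping. The bound on [n] matters: [uS] constrains [u] only up to index [s]. *)
  have uE n : (n <= s)%N -> u n = y + \sum_(j < s | (j < n)%N) g j (Y j).
    elim: n => [_|n IHn ltns]; first by rewrite u0 big_pred0 ?addr0.
    have -> : u n.+1 = u n + g (Ordinal ltns) (Y (Ordinal ltns))
      by exact: (uS (Ordinal ltns)).
    by rewrite IHn ?(ltnW ltns) // (sum_ord_ltS (Ordinal ltns)) addrA.
  exists Y; split=> [i|]; last by rewrite -us uE // sum_s.
  rewrite sum_midpoint_weight addrA -uE ?(ltnW (ltn_ord i)) //.
  by rewrite -half -uS.
exists (fun n => y + \sum_(j < s | (j < n)%N) g j (Y j)); split=> [||i].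
- by rewrite big_pred0 ?addr0.
- by rewrite sum_s.
(* The midpoint of two consecutive partial sums is the right-hand side of the [i]-th stage equation,
   hence [Y i]. *)
rewrite sum_ord_ltS addrA half; congr (_ + g i _).
by rewrite {1}YE sum_midpoint_weight addrA.
Qed.

Definition substep_increment (R : realType) (d m s : nat)
    (b : 'I_m.+1 -> 'I_s -> R) (f : 'I_m.+1 -> 'cV[R]_d -> 'cV[R]_d)
    (h : R) (J : 'I_m -> R) (i : 'I_s) (x : 'cV[R]_d) : 'cV[R]_d :=
  (b ord0 i * h) *: f ord0 x
  + \sum_(r < m) J r *: (b (lift ord0 r) i *: f (lift ord0 r) x).

(** Regroups a sum over substeps by drift and noise. The coefficients [c] are kept general to cover
    both the stages ([midpoint_weight]) and the update (constant 1). *)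
Lemma sum_substep_increment (R : realType) (d m s : nat)
    (b : 'I_m.+1 -> 'I_s -> R) (f : 'I_m.+1 -> 'cV[R]_d -> 'cV[R]_d)
    (h : R) (J : 'I_m -> R) (c : 'I_s -> R) (Y : 'I_s -> 'cV[R]_d) :
  \sum_(j < s) c j *: substep_increment b f h J j (Y j)
  = h *: (\sum_(j < s) (c j * b ord0 j) *: f ord0 (Y j))
    + \sum_(r < m) \sum_(j < s)
        (c j * b (lift ord0 r) j * J r) *: f (lift ord0 r) (Y j).
Proof.
rewrite exchange_big scaler_sumr -big_split; apply: eq_bigr => j _ /=.
rewrite scalerDr !scalerA scaler_sumr; congr (_ *: _ + _).
  by rewrite mulrA mulrC.
by apply: eq_bigr => r _; rewrite !scalerA mulrAC.
Qed.

(** The equivalence is algebraic and holds path by path, so the fields [f] and the real increments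
    [J] are arbitrary here. *)
Lemma midpoint_composite_srk (R : realType) (d m s : nat)
    (b : 'I_m.+1 -> 'I_s -> R) (f : 'I_m.+1 -> 'cV[R]_d -> 'cV[R]_d)
    (h : R) (J : 'I_m -> R) (y y' : 'cV[R]_d) :
  midpoint_composite b f h J y y' <-> srk_step (dirk_tableau b) f h J y y'.
Proof.
have aE l i j : tab_a (dirk_tableau b) l i j = midpoint_weight R s i j * b l j.
  rewrite /= mxE /midpoint_weight; case: ifP => _; first by rewrite mul1r.
  by case: ifP => _; [rewrite mulrC | rewrite mul0r].
have bE l j : tab_b (dirk_tableau b) l 0 j = 1 * b l j by rewrite mxE mul1r.
have stageE i (Y : 'I_s -> 'cV[R]_d) :
    y + h *: (\sum_(j < s) tab_a (dirk_tableau b) ord0 i j *: f ord0 (Y j))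
    + \sum_(r < m) \sum_(j < s)
        (tab_a (dirk_tableau b) (lift ord0 r) i j * J r)
          *: f (lift ord0 r) (Y j)
    = y + \sum_(j < s)
        midpoint_weight R s i j *: substep_increment b f h J j (Y j).
  rewrite sum_substep_increment addrA; congr (_ + _ *: _ + _).
    by apply: eq_bigr => j _; rewrite aE.
  by apply: eq_bigr => r _; apply: eq_bigr => j _; rewrite aE.
have updateE (Y : 'I_s -> 'cV[R]_d) :
    y + h *: (\sum_(i < s) tab_b (dirk_tableau b) ord0 0 i *: f ord0 (Y i))
    + \sum_(r < m) \sum_(i < s)
        (tab_b (dirk_tableau b) (lift ord0 r) 0 i * J r)
          *: f (lift ord0 r) (Y i)
    = y + \sum_(i < s) substep_increment b f h J i (Y i).
  (* The coefficient 1 is inserted so that [sum_substep_increment] applies; [bE] has the matching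
     factor. *)
  under [in RHS]eq_bigr do rewrite -[substep_increment _ _ _ _ _ _]scale1r.
  rewrite sum_substep_increment addrA; congr (_ + _ *: _ + _).
    by apply: eq_bigr => j _; rewrite bE.
  by apply: eq_bigr => r _; apply: eq_bigr => j _; rewrite bE.
have stepE i v v' :
    midpoint_step (b ord0 i * h) (f ord0)
      (fun r x => b (lift ord0 r) i *: f (lift ord0 r) x) J v v'
    <-> v' = v + substep_increment b f h J i (2^-1 *: (v' + v)).
  by rewrite /midpoint_step /substep_increment addrA.
apply: (iff_trans _ (iff_trans
  (midpoint_chainP (substep_increment b f h J) y y') _)).
  by split=> -[u [u0 us uS]]; exists u; split=> // i; apply/stepE.
split=> -[Y [YE y'E]]; exists Y.
  by rewrite updateE; split=> // i; rewrite stageE.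
by rewrite -updateE; split=> // i; rewrite -stageE.
Qed.

Theorem theorem3p3 (R : realType) (d m s : nat) (hs : (0 < s)%N)
  (H : 'I_m.+1 -> 'cV[R]_d -> R) (hH : forall l, smooth (H l))
  (B : 'cV[R]_d -> 'M[R]_d)
  (hskew : skew_symmetric B) (hjacobi : satisfies_jacobi B)
  (disp : measure_display) (Omega : measurableType disp)
  (P : probability Omega R)
  (W : 'I_m -> R -> {RV P >-> R}) (hW : standard_wiener W)
  (h : R) (hh : 0 < h)
  (t : nat -> R) (ht0 : 0 <= t 0%N) (ht : forall k, t k.+1 = t k + h)
  (b : 'I_m.+1 -> 'I_s -> R)
  (hb : forall (l : 'I_m.+1) (i : 'I_s), i.+1 = s ->
     b l i = 1 - \sum_(j < s | (j < i)%N) b l j) :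
  forall (k : nat) (w : Omega) (y y' : 'cV[R]_d),
    let J := fun r : 'I_m => W r (t k.+1) w - W r (t k) w in
    midpoint_composite b (poisson_field B H) h J y y' <->
    srk_step (dirk_tableau b) (poisson_field B H) h J y y'.
Proof. by move=> k w y y' J; exact: midpoint_composite_srk. Qed.
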